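(* Let $\alpha\ge 0$ and $\gamma\ge 1$ be real numbers and let $\beta\in\mathbb{C}$ satisfy $\gamma+\alpha\ge 3|\beta|$. Then for every integer $m\ge 0$ and every $z\in\mathfrak{U}$, $$\operatorname{Re}\left\{\frac{\mathbb{R}_{\alpha,\beta,\gamma}'(z)}{(\mathbb{R}_{\alpha,\beta,\gamma})_m'(z)}\right\}\ge \frac{\gamma+\alpha-3|\beta|}{\gamma+\alpha-|\beta|}$$ and $$\operatorname{Re}\left\{\frac{(\mathbb{R}_{\alpha,\beta,\gamma})_m'(z)}{\mathbb{R}_{\alpha,\beta,\gamma}'(z)}\right\}\ge \frac{\gamma+\alpha-|\beta|}{\gamma+\alpha+|\beta|}.$$
   Context: $\mathfrak{U}=\{z\in\mathbb{C}:|z|<1\}$ is the open unit disc. For real $\alpha\ge 0$, $\gamma\ge 1$ and $\beta\in\mathbb{C}$, the normalized (generalized) Rabotnov function is $$\mathbb{R}_{\alpha,\beta,\gamma}(z)=z+\sum_{n=1}^{\infty}A_n z^{n+1},\qquad A_n=\frac{\beta^n\,\Gamma(\gamma+\alpha)}{\Gamma((\gamma+\alpha)(n+1))},\qquad z\in\mathfrak{U},$$ where $\Gamma$ is the Gamma function. Its partial sums are $(\mathbb{R}_{\alpha,\beta,\gamma})_m(z)=z+\sum_{n=1}^{m}A_n z^{n+1}$ for $m\in\{1,2,3,\dots\}$ and $(\mathbb{R}_{\alpha,\beta,\gamma})_0(z)=z$. A prime denotes the derivative with respect to $z$. *)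

(* Defs.v *)
From mathcomp Require Export all_boot all_order all_algebra.
From mathcomp Require Export all_classical all_reals all_analysis.
From mathcomp Require Export complex.
Export Order.TTheory GRing.Theory Num.Theory.
Export numFieldNormedType.Exports.
Set Implicit Arguments.
Unset Strict Implicit.
Unset Printing Implicit Defensive.
Local Open Scope classical_set_scope.
Local Open Scope complex_scope.
Local Open Scope ring_scope.

(* Euler's integral; meaningful for 0 < s (Rintegral is 0 when it diverges) *)
Definition Gamma (R : realType) (s : R) : R :=
  \int[lebesgue_measure]_(t in `]0%R, +oo[) (t `^ (s - 1) * expR (- t)).

Definition rabotnov_coef (R : realType) (alpha gamma : R) (beta : R[i])
    (n : nat) : R[i] :=
  beta ^+ n * (Gamma (gamma + alpha))%:C
    / (Gamma ((gamma + alpha) * n.+1%:R))%:C.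

(* The codomain R[i]^o carries the normed module structure of the field R[i]
   over itself, so that limits are limits in C and derive1 is the complex
   derivative. *)
Definition rabotnov (R : realType) (alpha gamma : R) (beta : R[i])
    (z : R[i]) : R[i]^o :=
  z + limn (fun N : nat =>
    \sum_(1 <= n < N) rabotnov_coef alpha gamma beta n * z ^+ n.+1 : R[i]^o).

Definition rabotnov_psum (R : realType) (alpha gamma : R) (beta : R[i])
    (m : nat) (z : R[i]) : R[i]^o :=
  z + \sum_(1 <= n < m.+1) rabotnov_coef alpha gamma beta n * z ^+ n.+1.

(* Main.v *)
Require Import Defs.
From mathcomp Require Import ring lra zify measurable_realfun.
Set Implicit Arguments.
Unset Strict Implicit.
Unset Printing Implicit Defensive.
Local Open Scope complex_scope.
Local Open Scope ring_scope.
Import Normc.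

(* Put [s = gamma + alpha] and [r = |beta| / s <= 1/3]. Gamma is nondecreasing
   for arguments at least 2 and satisfies [Gamma (x + 1) = x * Gamma x], so
   [Gamma (s * n.+1) >= s * n * Gamma (s * n)] and inductively
   [|A_n| <= r ^ n / n!]. Hence the terms [d_n = (n + 1) A_n z ^ n] of the
   derivative satisfy [|d_n| <= 2 r ^ n |z|], and their absolute sum is at most
   [C |z|] where [C = 2 r / (1 - r) = 2 |beta| / (s - |beta|) <= 1]. If [x] is
   the part of that sum with [n <= m], then [|R_m' - 1| <= x] and
   [|R' - R_m'| <= C |z| - x], so
   [|R' / R_m' - 1| <= (C |z| - x) / (1 - x) <= C |z|]. Both bounds then hold
   for every nonzero point of the closed disc of centre 1 and radius [C]: there
   [Re w >= 1 - C] and [Re (1 / w) >= 1 / (1 + C)]. *)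

(** * The Gamma function *)

Section Gamma.
Local Open Scope classical_set_scope.
Variable R : realType.
Implicit Types p q t x y : R.
Local Notation mu := (@lebesgue_measure R).

(** Raising [u <= expR u] at [u = t / (2 * p)] to the power [p] gives the constant, at the price of
    half the exponential decay. *)
Lemma powR_expRN_bound p : 0 <= p ->
  exists2 K, 0 <= K & forall t, 0 <= t -> t `^ p * expR (- t) <= K * expR (- (2^-1 * t)).
Proof.
rewrite le_eqVlt => /orP[/eqP<-|p0].
  exists 1 => // t t0; rewrite powRr0 !mul1r ler_expR; lra.
exists ((2 * p) `^ p); first exact: powR_ge0.
move=> t t0.
have -> : expR (- (2^-1 * t)) = expR (t / (2 * p)) `^ p * expR (- t).
  by rewrite -expRM -!expRD; congr expR; field; rewrite gt_eqF.
rewrite mulrA ler_wpM2r ?expR_ge0// -powRM ?expR_ge0//; last lra.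
apply: ge0_ler_powR; rewrite ?nnegrE ?mulr_ge0 ?expR_ge0//; [exact: ltW | exact: ltW |].
rewrite mulrC -ler_pdivrMr ?mulr_gt0//.
by apply: le_trans (expR_ge1Dx _); lra.
Qed.

Lemma cvg_powR_at_right p : 0 <= p -> t `^ p @[t --> 0^'+] --> (0 : R) `^ p.
Proof.
rewrite le_eqVlt => /orP[/eqP<-|p0].
  by under eq_fun do rewrite powRr0; rewrite powRr0; exact: cvg_cst.
by rewrite powR0 ?gt_eqF//; exact: powR_cvg0.
Qed.

Lemma continuous_expRMN (r : R) : continuous (fun t => expR (- (r * t))).
Proof.
move=> x; apply: continuous_comp; last exact: continuous_expR.
by apply: cvgN; apply: cvgMl_tmp; exact: cvg_id.
Qed.

Lemma cvg_expRMN (r : R) : 0 < r -> expR (- (r * t)) @[t --> +oo] --> (0 : R).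
Proof.
move=> r0; apply: (@cvg_comp _ _ _ _ (fun z => expR (- z)) _ (pinfty_nbhs R)).
  exact: gt0_cvgMry.
exact: cvgr_expR.
Qed.

Lemma integral_expR_half K : 0 <= K ->
  (\int[mu]_(t in `]0%R, +oo[) (K * expR (- (2^-1 * t)))%:E = (2 * K)%:E)%E.
Proof.
move=> K0; rewrite integral_itv_obnd_cbnd; last first.
  apply/measurable_EFinP; apply: measurable_funTS; apply: continuous_measurable_fun => x.
  by apply: cvgMl_tmp; exact: continuous_expRMN.
rewrite (@ge0_continuous_FTC2y _ _ (fun t => - (2 * K) * expR (- (2^-1 * t))) _ 0).
- by rewrite mulr0 oppr0 expR0 mulr1 EFinN oppeK add0e.
- by move=> x _; rewrite mulr_ge0 ?expR_ge0.
- apply: continuous_subspaceT => x.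
  by apply: cvgMl_tmp; exact: continuous_expRMN.
- rewrite -[X in _ --> X](mulr0 (- (2 * K))); apply: cvgMl_tmp.
  by apply: cvg_expRMN; lra.
- by move=> x _; exact: ex_derive.
- apply: cvg_at_right_filter.
  by apply: cvgMl_tmp; exact: continuous_expRMN.
- move=> x _; rewrite derive1E derive_val /GRing.scale/=; lra.
Qed.

Let mf p (D : set R) : measurable_fun D (fun t => t `^ p * expR (- t)).
Proof.
apply: measurable_funTS; apply: measurable_funM; first exact: measurable_powR.
by apply: measurableT_comp => //; exact: measurable_funN.
Qed.

Lemma integrable_expR_half K : 0 <= K ->
  mu.-integrable `]0%R, +oo[ (EFin \o (fun t => K * expR (- (2^-1 * t)))).
Proof.
move=> K0; apply/integrableP; split.
  apply/measurable_EFinP; apply: measurable_funTS; apply: continuous_measurable_fun => x.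
  by apply: cvgMl_tmp; exact: continuous_expRMN.
under eq_integral do rewrite /= ger0_norm ?mulr_ge0 ?expR_ge0//.
by rewrite /= integral_expR_half// ltry.
Qed.

Lemma integrable_Gamma p : 0 <= p ->
  mu.-integrable `]0%R, +oo[ (EFin \o (fun t => t `^ p * expR (- t))).
Proof.
move=> p0; have [K K0 HK] := powR_expRN_bound p0.
apply: le_integrable (integrable_expR_half K0) => //.
- by apply/measurable_EFinP; exact: mf.
- move=> x /=; rewrite in_itv/= andbT => x0.
  rewrite lee_fin !ger0_norm ?mulr_ge0 ?expR_ge0 ?powR_ge0//.
  exact/HK/ltW.
Qed.

Let integrable_subr (i : interval R) (f g : R -> R) :
  mu.-integrable [set` i] (EFin \o f) -> mu.-integrable [set` i] (EFin \o g) ->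
  mu.-integrable [set` i] (EFin \o (f \- g)).
Proof.
move=> If Ig; rewrite (_ : EFin \o (f \- g) = ((EFin \o f) \- (EFin \o g))%E)//.
exact: integrableB.
Qed.

(** Integration by parts: the boundary terms vanish at 0 and at infinity. With [1 <= x] the
    integrand of [Gamma x] is right-continuous at 0. *)
Lemma GammaD1 x : 1 <= x -> Gamma (x + 1) = x * Gamma x.
Proof.
move=> x1.
have x0 : 0 < x by lra.
have [K K0 HK] := powR_expRN_bound (ltW x0).
(* The derivative of [t `^ x * expR (- t)] changes sign, while the fundamental
   theorem on a half-line needs a nonnegative integrand: [h] absorbs the
   negative part with an integrable majorant, subtracted again at the end. *)
pose g t := x * (t `^ (x - 1) * expR (- t)).
pose h t := K * expR (- (2^-1 * t)) - t `^ x * expR (- t).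
have cE : continuous (fun t : R => expR (- t)).
  move=> t; apply: continuous_comp; last exact: continuous_expR.
  by apply: cvgN; exact: cvg_id.
have cP p t : 0 < t -> {for t, continuous (fun t => t `^ p)}.
  move=> t0; apply/differentiable_continuous/derivable1_diffP.
  by apply: derivable_powR; rewrite in_itv/= andbT.
(* The primitive of [g + h] supplied below equals [- (2 * K)] at 0 and tends to 0 at infinity. *)
have int_gh : (\int[mu]_(t in `]0%R, +oo[) (g t + h t)%:E = (2 * K)%:E)%E.
  rewrite integral_itv_obnd_cbnd; last first.
    apply/measurable_EFinP; apply: measurable_funD.
      by apply: measurable_funM => //; exact: mf.
    apply: measurable_funB; last exact: mf.
    apply: measurable_funTS; apply: continuous_measurable_fun => t.
    by apply: cvgMl_tmp; exact: continuous_expRMN.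
  rewrite (@ge0_continuous_FTC2y _ _
    (fun t => t `^ x * expR (- t) - 2 * K * expR (- (2^-1 * t))) _ 0).
  - by rewrite powR0 ?gt_eqF// mul0r mulr0 oppr0 expR0 mulr1 sub0r EFinN oppeK add0e.
  - move=> t t0; rewrite addr_ge0// /g ?mulr_ge0 ?expR_ge0 ?powR_ge0 ?(ltW x0)//.
    by rewrite subr_ge0 HK.
  - apply/continuous_within_itvcyP; split.
      move=> t; rewrite in_itv/= andbT => t0.
      apply: cvgD.
        by apply: cvgMl_tmp; apply: cvgM; [exact: cP|exact: cE].
      apply: cvgB; first by apply: cvgMl_tmp; exact: continuous_expRMN.
      by apply: cvgM; [exact: cP|exact: cE].
    apply: cvgD.
      apply: cvgMl_tmp; apply: cvgM; last by apply: cvg_at_right_filter; exact: cE.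
      by apply: cvg_powR_at_right; lra.
    apply: cvgB.
      by apply: cvgMl_tmp; apply: cvg_at_right_filter; exact: continuous_expRMN.
    apply: cvgM; last by apply: cvg_at_right_filter; exact: cE.
    by apply: cvg_powR_at_right; lra.
  - rewrite -[X in _ --> X](subr0 0); apply: cvgB.
      apply: (@squeeze_cvgr _ _ _ _ (cst 0) (fun t => K * expR (- (2^-1 * t)))).
      + near=> t; rewrite mulr_ge0 ?expR_ge0 ?powR_ge0//= HK//.
      + exact: cvg_cst.
      + rewrite -[X in _ --> X](mulr0 K); apply: cvgMl_tmp; apply: cvg_expRMN; lra.
    rewrite -[X in _ --> X](mulr0 (2 * K)); apply: cvgMl_tmp; apply: cvg_expRMN; lra.
  - by move=> t t0; have dP := is_derive1_powR x t0; exact: ex_derive.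
  - apply: cvgB; last first.
      by apply: cvgMl_tmp; apply: cvg_at_right_filter; exact: continuous_expRMN.
    apply: cvgM; last by apply: cvg_at_right_filter; exact: cE.
    by apply: cvg_powR_at_right; lra.
  - move=> t; rewrite in_itv/= andbT => t0.
    rewrite derive1E.
    have dP := is_derive1_powR x t0.
    rewrite derive_val /GRing.scale/= /g /h; lra.
have I1 : mu.-integrable `]0%R, +oo[ (EFin \o (fun t => t `^ (x - 1) * expR (- t))).
  by apply: integrable_Gamma; lra.
have I2 := integrable_Gamma (ltW x0).
have IK := integrable_expR_half K0.
have Ig : mu.-integrable `]0%R, +oo[ (EFin \o g).
  exact: (integrableZl _ x I1).
have Ih : mu.-integrable `]0%R, +oo[ (EFin \o h).
  exact: integrable_subr.
have := congr1 fine int_gh.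
rewrite -[LHS]/(\int[mu]_(t in `]0%R, +oo[) (g t + h t))%R RintegralD//.
rewrite /g /h RintegralB// RintegralZl//.
(* The majorant alone also integrates to [2 * K], so the two constants cancel. *)
rewrite [X in _ + (X - _)]/Rintegral integral_expR_half//=.
rewrite addrCA -[RHS]addr0 => /addrI/eqP; rewrite subr_eq0 => /eqP ->.
by rewrite /Gamma addrK.
Unshelve. all: by end_near. Qed.

(* By convexity of [fun p => t `^ p], its slope between [p] and [q] is at least
   its slope between 0 and 1. Integrating against [expR (- t)], the left-hand
   side gives [(q - p) * (Gamma 2 - Gamma 1) = 0]. *)
Lemma powR_sub_ge p q t : 1 <= p -> p <= q -> 0 < t ->
  (q - p) * (t - 1) <= t `^ q - t `^ p.
Proof.
move=> p1 pq t0.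
have tln : t - 1 <= t * ln t.
  have tV0 : 0 < t^-1 by rewrite invr_gt0.
  have : ln (1 + (t^-1 - 1)) <= t^-1 - 1 by apply: le_ln1Dx; lra.
  rewrite addrC subrK lnV ?posrE// -(ler_pM2l t0) mulrBr divff ?gt_eqF//; lra.
(* Since [1 <= p], the difference of the two powers of [t] has the same sign as [ln t] on either
   side of 1. *)
have pln : t * ln t <= t `^ p * ln t.
  have [t1|/ltW t1] := leP 1 t.
    by rewrite ler_wpM2r ?ln_ge0// le1r_powR.
  by rewrite ler_wnM2r ?ln_le0// ge1r_powR ?t0.
have -> : t `^ q = t `^ p * t `^ (q - p).
  by rewrite -powRD ?subrKC// (gt_eqF t0) implybT.
have eD : 1 + (q - p) * ln t <= t `^ (q - p).
  by rewrite /powR gt_eqF// expR_ge1Dx.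
have := ler_wpM2l (powR_ge0 t p) eD.
have : (q - p) * (t - 1) <= (q - p) * (t `^ p * ln t).
  by rewrite ler_wpM2l ?subr_ge0// (le_trans tln).
lra.
Qed.

(** Integrates [powR_sub_ge] at the exponents [x - 1] and [y - 1]; its requirement [1 <= p] becomes
    [2 <= x]. *)
Lemma le_Gamma x y : 2 <= x -> x <= y -> Gamma x <= Gamma y.
Proof.
move=> x2 xy.
have I1 := @integrable_Gamma 1 ler01.
have I0 := @integrable_Gamma 0 (lexx 0).
have Ix : mu.-integrable `]0%R, +oo[ (EFin \o (fun t => t `^ (x - 1) * expR (- t))).
  by apply: integrable_Gamma; lra.
have Iy : mu.-integrable `]0%R, +oo[ (EFin \o (fun t => t `^ (y - 1) * expR (- t))).
  by apply: integrable_Gamma; lra.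
have I10 := integrable_subr I1 I0.
have Iyx := integrable_subr Iy Ix.
have Iz : mu.-integrable `]0%R, +oo[
    (EFin \o (fun t => (y - x) * (t `^ 1 * expR (- t) - t `^ 0 * expR (- t)))).
  exact: (integrableZl _ (y - x) I10).
have pt t : `]0%R, +oo[%classic t -> (y - x) * (t `^ 1 * expR (- t) - t `^ 0 * expR (- t))
    <= t `^ (y - 1) * expR (- t) - t `^ (x - 1) * expR (- t).
  rewrite /= in_itv/= andbT => t0.
  rewrite -!mulrBl mulrA; apply: ler_wpM2r (expR_ge0 _) _ _ _.
  rewrite (powRr1 (ltW t0)) powRr0 (_ : y - x = (y - 1) - (x - 1)); last by ring.
  by apply: powR_sub_ge => //; lra.
have /(_ (measurable_itv _)) E1 := RintegralB _ I1 I0.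
have /(_ (measurable_itv _)) Eyx := RintegralB _ Iy Ix.
have /(_ (measurable_itv _)) Ez := RintegralZl (y - x) _ I10.
have /(_ (measurable_itv _) pt) := le_Rintegral _ Iz Iyx.
have : Gamma (1 + 1) = Gamma 1 :> R by rewrite GammaD1// mul1r.
rewrite /Gamma addrK subrr => G10.
by rewrite Ez E1 Eyx G10 subrr mulr0 subr_ge0.
Qed.

Lemma Gamma_ge0 x : 0 <= Gamma x.
Proof. by apply: Rintegral_ge0 => t _; rewrite mulr_ge0 ?powR_ge0 ?expR_ge0. Qed.

Lemma Gamma_mulS_ge x n : 1 <= x ->
  Gamma x * x ^+ n * n`!%:R <= Gamma (x * n.+1%:R).
Proof.
move=> x1; elim: n => [|n IH]; first by rewrite expr0 fact0 mulr1n !mulr1.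
have x0 : 0 <= x := le_trans ler01 x1.
have n1 : 1 <= n.+1%:R :> R by rewrite ler1n.
have xn1 : 1 <= x * n.+1%:R by apply: le_trans x1 _; apply: ler_peMr.
(* One unit step fits below the increment [x >= 1] of the argument, and it starts from an argument
   at least 1, so [le_Gamma] applies beyond it. *)
apply: (@le_trans _ _ (Gamma (x * n.+1%:R + 1))); last first.
  by apply: le_Gamma; rewrite -?[n.+2%:R]natr1 ?mulrDr ?mulr1 ?lerD2l ?lerD2r.
have xn0 := le_trans ler01 xn1.
rewrite GammaD1// (le_trans _ (ler_wpM2l xn0 IH))// factS natrM exprS.
by rewrite le_eqVlt; apply/orP; left; apply/eqP; ring.
Qed.

End Gamma.

(** * Complex series *)

Section ComplexSeries.
Local Open Scope classical_set_scope.
Variable R : realType.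
Implicit Types (w z L : R[i]) (a c : nat -> R[i]) (q r x y B M : R).

Lemma normr_normc z : `|z| = (normc z)%:C.
Proof. by []. Qed.

Lemma normc_ge0 z : 0 <= normc z.
Proof. by rewrite -lecR -normr_normc normr_ge0. Qed.

Lemma ler_normcD w z : normc (w + z) <= normc w + normc z.
Proof. exact: le_normcD. Qed.

Lemma ler_normcB w z : normc (w - z) <= normc w + normc z.
Proof. by rewrite -[normc z]normcN; exact: le_normcD. Qed.

Lemma normcX z n : normc (z ^+ n) = normc z ^+ n.
Proof. by elim: n => [|n IH]; rewrite ?expr0 ?normc1// !exprS normcM IH. Qed.

Lemma normc_nat n : normc (n%:R : R[i]) = n%:R.
Proof. by rewrite normcMn normc1. Qed.

Lemma ler_normc_sum (I : Type) (s : seq I) (P : pred I) (F : I -> R[i]) :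
  normc (\sum_(i <- s | P i) F i) <= \sum_(i <- s | P i) normc (F i).
Proof.
elim/big_ind2 : _ => [|x1 x2 y1 y2 h1 h2|//]; first by rewrite normc0.
exact: le_trans (ler_normcD _ _) (lerD h1 h2).
Qed.

Lemma ler_sum_geometric M q m n : 0 <= M -> 0 <= q < 1 ->
  \sum_(m <= k < n) M * q ^+ k <= M / (1 - q) * q ^+ m.
Proof.
move=> M0 /andP[q0 q1]; have q10 : 0 < 1 - q by lra.
have [nm|/ltnW mn] := leqP n m.
  by rewrite big_geq// !mulr_ge0 ?exprn_ge0 ?invr_ge0 ?(ltW q10).
suff -> : \sum_(m <= k < n) M * q ^+ k = M / (1 - q) * (q ^+ m - q ^+ n).
  by rewrite ler_wpM2l ?divr_ge0 ?(ltW q10)// gerBl exprn_ge0.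
rewrite (eq_bigr (fun k => M / (1 - q) * (q ^+ k - q ^+ k.+1))); last first.
  by move=> k _; rewrite exprS; field; rewrite gt_eqF.
rewrite -mulr_sumr; congr (_ * _).
rewrite -opprB -(telescope_sumr (fun k => q ^+ k) mn) -sumrN.
by apply: eq_bigr => k _; rewrite opprB.
Qed.

Lemma cvg_geometric0 B q : 0 <= q < 1 -> B * q ^+ n @[n --> \oo] --> (0 : R).
Proof. by move=> /andP[q0 q1]; apply: cvg_geometric; rewrite ger0_norm. Qed.

(** Infinite sums are handled below through explicit geometric errors; this lemma lets such an error
    tend to 0. *)
Lemma ler_of_geometric_error B q x y : 0 <= q < 1 ->
  (\forall n \near \oo, x <= y + B * q ^+ n) -> x <= y.
Proof.
move=> hq xy.
have cv : y + B * q ^+ n @[n --> \oo] --> y.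
  by rewrite -[X in _ --> X]addr0; apply: cvgD; [exact: cvg_cst|exact: cvg_geometric0].
rewrite -(cvg_lim _ cv)//; apply: limr_ge => //.
by apply/cvg_ex; exists y.
Qed.

Lemma real_series_geometric (u : nat -> R) M q : 0 <= M -> 0 <= q < 1 ->
  (forall n, `|u n| <= M * q ^+ n) ->
  exists l, forall n, `|l - \sum_(0 <= k < n) u k| <= M / (1 - q) * q ^+ n.
Proof.
move=> M0 hq hu; have /andP[q0 q1] := hq.
have cu : cvgn (series u).
  apply: normed_cvg; apply: (series_le_cvg _ _ hu) => // [n|].
    by rewrite mulr_ge0 ?exprn_ge0.
  by apply: is_cvg_geometric_series; rewrite ger0_norm.
exists (limn (series u)) => n.
have cn : (`|series u k - series u n| @[k --> \oo] --> `|limn (series u) - series u n|).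
  by apply: cvg_norm; apply: cvgB => //; exact: cvg_cst.
rewrite -/(series u n) -(cvg_lim _ cn)//; apply: limr_le.
  by apply/cvg_ex; eexists; exact: cn.
exists n => // k /= nk.
rewrite sub_series_geq// (le_trans (ler_norm_sum _ _ _))//.
apply: le_trans (ler_sum_geometric n k M0 hq).
exact: ler_sum.
Qed.

Lemma normc_le_ReIm z : normc z <= `|complex.Re z| + `|complex.Im z|.
Proof.
case: z => x y /=.
rewrite -(ler_pXn2r (ltn0Sn 1)) ?nnegrE ?sqrtr_ge0 ?addr_ge0//.
rewrite sqr_sqrtr ?addr_ge0 ?sqr_ge0// sqrrD !real_normK ?num_real//.
by rewrite lerD2r lerDl mulrn_wge0// mulr_ge0.
Qed.

Lemma normr_Re_le z : `|complex.Re z| <= normc z.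
Proof. by rewrite -lecR; exact: normc_ge_Re. Qed.

Lemma normr_Im_le z : `|complex.Im z| <= normc z.
Proof.
case: z => x y /=; rewrite -[leLHS]sqrtr_sqr ler_wsqrtr// lerDr sqr_ge0//.
Qed.

(** Real and imaginary parts are summed separately, each with its own tail bound; hence the factor
    2. *)
Lemma complex_series_geometric a M q : 0 <= M -> 0 <= q < 1 ->
  (forall n, (0 < n)%N -> normc (a n) <= M * q ^+ n) ->
  exists L, forall n,
    normc (L - \sum_(1 <= k < n) a k) <= 2 * (M / (1 - q)) * q ^+ n.
Proof.
move=> M0 hq ha; have /andP[q0 q1] := hq.
(* The sums start at 1 and nothing is assumed on [a 0], so it is replaced by 0. *)
pose a' n := if n is 0 then 0 else a n.
have ha' n : normc (a' n) <= M * q ^+ n.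
  by case: n => [|n]; [rewrite [leLHS]normc0 mulr1 | exact: ha].
have sum_a' n : \sum_(1 <= k < n) a k = \sum_(0 <= k < n) a' k.
  case: n => [|n]; first by rewrite !big_geq.
  by rewrite [RHS]big_ltn// add0r; apply: eq_big_nat => -[].
have [l hl] := real_series_geometric M0 hq (fun n => le_trans (normr_Re_le _) (ha' n)).
have [l' hl'] := real_series_geometric M0 hq (fun n => le_trans (normr_Im_le _) (ha' n)).
exists (l +i* l') => n; rewrite sum_a'.
apply: le_trans (normc_le_ReIm _) _.
rewrite -mulrA mulr_natl mulr2n; apply: lerD.
  rewrite raddfB/= (raddf_sum (@complex.Re R : Rcomplex R -> R)).
  exact: hl.
rewrite raddfB/= (raddf_sum (@complex.Im R : Rcomplex R -> R)).
exact: hl'.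
Qed.

Lemma limn_geometric_error (u : nat -> R[i]) L B q : 0 <= q < 1 ->
  (forall n, normc (L - u n) <= B * q ^+ n) ->
  limn (u : nat -> R[i]^o) = L.
Proof.
move=> hq hu; apply: cvg_lim => //; apply/cvgrPdist_lt => e e0.
(* The radius [e] lives in [R[i]]; being positive there, it is real. *)
have er : e = (complex.Re e)%:C by rewrite RRe_real// gtr0_real.
have e0' : 0 < complex.Re e by rewrite -ltcR -er.
near=> n.
rewrite er [X in X < _]normr_normc ltcR (le_lt_trans (hu n))//.
apply: le_lt_trans (ler_norm _) _; rewrite -normrN -sub0r.
near: n.
by move/cvgrPdist_lt : (cvg_geometric0 B hq); apply.
Unshelve. all: by end_near. Qed.

(** A quadratic remainder, divided by [h], is linear in [h] and tends to 0. Derivatives of both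
    finite and infinite sums are obtained this way. *)
Lemma derive1_quadratic_error (f : R[i] -> R[i]^o) z D r B : 0 < r -> 0 <= B ->
  (forall h, normc h <= r -> normc (f (h + z) - f z - h * D) <= B * normc h ^+ 2) ->
  derive1 f z = D.
Proof.
move=> r0 B0 hf; apply: cvg_lim => //; apply/cvgrPdist_le => e e0.
have er : e = (complex.Re e)%:C by rewrite RRe_real// gtr0_real.
have e0' : 0 < complex.Re e by rewrite -ltcR -er.
(* [B] may be 0, so the admissible size of [h] is found by dividing by [B + 1]. *)
have B1 : 0 < B + 1 by lra.
near=> h.
have h0 : h != 0 by near: h; exact: nbhs_dnbhs_neq.
have hr : normc h <= r.
  rewrite -lecR -normr_normc ltW//; near: h; apply: dnbhs0_lt; by rewrite ltcR.
have he : (B + 1) * normc h <= complex.Re e.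
  rewrite mulrC -ler_pdivlMr// -lecR -normr_normc ltW//; near: h; apply: dnbhs0_lt.
  by rewrite ltcR divr_gt0.
have nh0 : 0 < normc h by rewrite -ltcR -normr_normc normr_gt0.
have -> : D - h^-1 *: (f (h + z) - f z) = - (h^-1 * (f (h + z) - f z - h * D)).
  by rewrite /GRing.scale/= [in RHS]mulrBr mulKf// opprB.
rewrite er [X in X <= _]normr_normc lecR normcN normcM normcV.
rewrite mulrC ler_pdivrMr// (le_trans (hf h hr))// expr2 mulrA ler_wpM2r ?normc_ge0//.
apply: le_trans he; rewrite ler_wpM2r ?normc_ge0//; lra.
Unshelve. all: by end_near. Qed.

End ComplexSeries.

(** * Termwise differentiation of power series in the unit disc *)

Section PowerSeries.
Local Open Scope classical_set_scope.
Variable R : realType.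
Implicit Types (w z L : R[i]) (c : nat -> R[i]) (q r x y B M : R).

(** Taylor remainder of a power, by induction: each step adds at most [n.+1] to the constant, and
    [n ^ 2 + n.+1 <= n.+1 ^ 2]. *)
Lemma normc_powers_sub w z n : normc w <= 1 -> normc z <= 1 ->
  normc (w ^+ n.+1 - z ^+ n.+1 - n.+1%:R * (w - z) * z ^+ n)
    <= n%:R ^+ 2 * normc (w - z) ^+ 2.
Proof.
move=> w1 z1; have wz0 := normc_ge0 (w - z).
elim: n => [|n IH].
  by rewrite !expr1 expr0 mulr1 mul1r subrr normc0 expr0n mul0r.
have -> : w ^+ n.+2 - z ^+ n.+2 - n.+2%:R * (w - z) * z ^+ n.+1 =
    w * (w ^+ n.+1 - z ^+ n.+1 - n.+1%:R * (w - z) * z ^+ n)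
    + n.+1%:R * (w - z) ^+ 2 * z ^+ n.
  by rewrite -[n.+2%:R]natr1 !exprS; ring.
apply: le_trans (ler_normcD _ _) _.
rewrite !normcM !normcX normc_nat.
have zn1 : normc z ^+ n <= 1 by rewrite exprn_ile1 ?normc_ge0.
have h1 : normc w * normc (w ^+ n.+1 - z ^+ n.+1 - n.+1%:R * (w - z) * z ^+ n)
    <= n%:R ^+ 2 * normc (w - z) ^+ 2.
  by apply: le_trans IH; rewrite ler_piMl ?normc_ge0.
have h2 : n.+1%:R * normc (w - z) ^+ 2 * normc z ^+ n <= n.+1%:R * normc (w - z) ^+ 2.
  by rewrite ler_piMr// mulr_ge0 ?exprn_ge0.
apply: le_trans (lerD h1 h2) _.
rewrite -mulrDl ler_wpM2r ?exprn_ge0// -natrX -natrD -natrX ler_nat.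
by rewrite -!mulnn; nia.
Qed.

(** The factorial in the coefficient bound absorbs the factor [n.+1] from differentiation and, in
    the next lemma, the [n ^ 2] from the Taylor remainder; a geometric series of ratio [r] is
    left. *)
Lemma leqS_double_fact n : (n.+1 <= 2 * n`!)%N.
Proof. by case: n => // n; elim: n => // n IH; rewrite factS; nia. Qed.

Lemma sqrn_le_double_fact n : (n ^ 2 <= 2 * n`!)%N.
Proof. by case: n => // n; rewrite factS; have := leqS_double_fact n; nia. Qed.

Variables (r : R) (c : nat -> R[i]).
Hypothesis r01 : 0 <= r < 1.
Hypothesis c_le : forall n, normc (c n) <= r ^+ n / n`!%:R.

Let r0 : 0 <= r. Proof. by case/andP: r01. Qed.

Let fact_gt0R n : 0 < n`!%:R :> R. Proof. by rewrite ltr0n fact_gt0. Qed.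

Lemma coef_mul_le k n : (k <= 2 * n`!)%N -> k%:R * normc (c n) <= 2 * r ^+ n.
Proof.
move=> hk; apply: le_trans (ler_wpM2l (ler0n _ _) (c_le n)) _.
rewrite mulrCA [leRHS]mulrC ler_wpM2l ?exprn_ge0// ler_pdivrMr//.
by rewrite -natrM ler_nat.
Qed.

Lemma derive_coef_le z n : normc z <= 1 ->
  normc (n.+1%:R * c n * z ^+ n) <= 2 * r ^+ n.
Proof.
move=> z1; rewrite !normcM normc_nat normcX.
apply: le_trans (coef_mul_le (leqS_double_fact n)).
by rewrite ler_piMr ?mulr_ge0 ?normc_ge0// exprn_ile1 ?normc_ge0.
Qed.

Let K := 2 / (1 - r).

Let K0 : 0 <= K.
Proof. by have /andP[_ r1] := r01; rewrite divr_ge0// subr_ge0 ltW. Qed.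

(** The Taylor remainders are summed termwise. The constant [K] does not depend on [N], so the bound
    passes to the limit. *)
Lemma partial_sum_quadratic_error w z N : normc w <= 1 -> normc z <= 1 ->
  normc (\sum_(1 <= n < N) c n * w ^+ n.+1 - \sum_(1 <= n < N) c n * z ^+ n.+1
         - (w - z) * \sum_(1 <= n < N) n.+1%:R * c n * z ^+ n)
    <= K * normc (w - z) ^+ 2.
Proof.
move=> w1 z1; rewrite mulr_sumr -!sumrB.
apply: le_trans (ler_normc_sum _ _ _) _.
apply: (@le_trans _ _ (\sum_(1 <= n < N) 2 * r ^+ n * normc (w - z) ^+ 2)).
  apply: ler_sum => n _.
  have -> : c n * w ^+ n.+1 - c n * z ^+ n.+1 - (w - z) * (n.+1%:R * c n * z ^+ n)
    = c n * (w ^+ n.+1 - z ^+ n.+1 - n.+1%:R * (w - z) * z ^+ n) by ring.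
  rewrite normcM.
  apply: le_trans (ler_wpM2l (normc_ge0 _) (normc_powers_sub n w1 z1)) _.
  rewrite mulrA ler_wpM2r ?exprn_ge0 ?normc_ge0// mulrC -natrX.
  exact/coef_mul_le/sqrn_le_double_fact.
rewrite -mulr_suml ler_wpM2r ?exprn_ge0 ?normc_ge0//.
apply: le_trans (ler_sum_geometric 1 N (ler0n R 2) r01) _.
by have /andP[_ r1] := r01; rewrite ler_piMr// expr1 ltW.
Qed.

Lemma derive1_partial_sum N z : normc z < 1 ->
  derive1 (fun w => w + \sum_(1 <= n < N) c n * w ^+ n.+1 : R[i]^o) z =
  1 + \sum_(1 <= n < N) n.+1%:R * c n * z ^+ n.
Proof.
(* The radius [1 - normc z] keeps [h + z] in the closed unit disc. *)
move=> z1; apply: (@derive1_quadratic_error _ _ _ _ (1 - normc z) K) => //.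
  by rewrite subr_gt0.
move=> h hh.
have hz1 : normc (h + z) <= 1 by apply: le_trans (ler_normcD _ _) _; lra.
have := partial_sum_quadratic_error N hz1 (ltW z1).
rewrite addrK; congr (normc _ <= _); ring.
Qed.

(** Up to tails of order [r ^ N], the remainder of the series is that of its partial sum, which is
    quadratic uniformly in [N]. The rate for [D] is kept because the tail of the derivative is
    estimated later. *)
Lemma derive1_series z : normc z < 1 ->
  exists D : R[i], [/\ exists B, forall N,
      normc (D - \sum_(1 <= n < N) n.+1%:R * c n * z ^+ n) <= B * r ^+ N
    & derive1 (fun w =>
        w + limn (fun N => \sum_(1 <= n < N) c n * w ^+ n.+1 : R[i]^o) : R[i]^o) z
      = 1 + D].
Proof.
move=> z1.
have [D hD] := complex_series_geometric (ler0n R 2) r01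
  (fun n _ => derive_coef_le n (ltW z1)).
exists D; split; first by eexists; exact: hD.
set S := fun w N => \sum_(1 <= n < N) c n * w ^+ n.+1.
have hS w : normc w <= 1 -> exists2 L, limn (S w : nat -> R[i]^o) = L &
    forall N, normc (L - S w N) <= 2 * K * r ^+ N.
  move=> w1.
  have ha n : (0 < n)%N -> normc (c n * w ^+ n.+1) <= 2 * r ^+ n.
    move=> _; rewrite normcM normcX.
    apply: le_trans (coef_mul_le (k := 1) _); last by rewrite muln_gt0 fact_gt0.
    by rewrite mul1r ler_piMr ?normc_ge0// exprn_ile1 ?normc_ge0.
  have [L hL] := complex_series_geometric (ler0n R 2) r01 ha.
  by exists L => //; exact: limn_geometric_error r01 hL.
apply: (@derive1_quadratic_error _ _ _ _ (1 - normc z) K) => //.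
  by rewrite subr_gt0.
move=> h hh.
have hz1 : normc (h + z) <= 1 by apply: le_trans (ler_normcD _ _) _; lra.
have [L' -> hL'] := hS _ hz1; have [L -> hL] := hS _ (ltW z1).
(* Two tails come from the values at [h + z] and [z], and one, multiplied by [h], from [D]. *)
apply: (@ler_of_geometric_error _ (2 * K * 2 + normc h * (2 * K)) r) => //.
apply: nearW => N.
have := partial_sum_quadratic_error N hz1 (ltW z1).
rewrite addrK => hN.
have -> : h + z + L' - (z + L) - h * (1 + D) =
   (S (h + z) N - S z N - h * \sum_(1 <= n < N) n.+1%:R * c n * z ^+ n)
   + ((L' - S (h + z) N) - (L - S z N)
       - h * (D - \sum_(1 <= n < N) n.+1%:R * c n * z ^+ n)) by ring.
apply: le_trans (ler_normcD _ _) _; apply: lerD => //.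
apply: le_trans (ler_normcB _ _) _; rewrite mulrDl; apply: lerD.
  apply: le_trans (ler_normcB _ _) _.
  by apply: le_trans (lerD (hL' N) (hL N)) _; lra.
by rewrite normcM -mulrA ler_wpM2l ?normc_ge0.
Qed.

End PowerSeries.

(** * The quotient of the derivatives *)

Section Quotient.
Variable R : realType.
Implicit Types (w f g : R[i]) (C x y : R).

Lemma normc_sqr w : normc w ^+ 2 = complex.Re w ^+ 2 + complex.Im w ^+ 2.
Proof. by case: w => u v /=; rewrite sqr_sqrtr// addr_ge0 ?sqr_ge0. Qed.

Lemma Re_disc_ge w C : normc (w - 1) <= C -> 1 - C <= complex.Re w.
Proof.
move=> h; have := le_trans (normr_Re_le _) h.
by rewrite raddfB/= ler_norml => /andP[]; lra.
Qed.

(** For [w = u + iv] the disc gives [u ^ 2 + v ^ 2 <= C ^ 2 - 1 + 2 * u], which is at most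
    [(1 + C) * u] because [u <= 1 + C] and [C <= 1]. For [C = 1] the disc contains 0, whose inverse
    is 0 by convention. *)
Lemma Re_inv_disc_ge w C : w != 0 -> C <= 1 -> normc (w - 1) <= C ->
  1 / (1 + C) <= complex.Re w^-1.
Proof.
move=> w0 C1 h; have C0 := le_trans (normc_ge0 _) h.
have h2 : normc (w - 1) ^+ 2 <= C ^+ 2 by rewrite lerXn2r ?nnegrE ?normc_ge0.
have w2 : 0 < normc w ^+ 2.
  rewrite exprn_gt0// lt_neqAle normc_ge0 andbT eq_sym.
  by apply: contra_neq w0; exact: eq0_normc.
move: h2 w2; rewrite !normc_sqr; case: w {w0} h => u v h /=.
rewrite subr0 => h2 w2.
have u1 : u <= 1 + C.
  have := le_trans (normr_Re_le _) h; rewrite /= ler_norml => /andP[_]; lra.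
rewrite ler_pdivrMr; last lra.
rewrite mulrAC ler_pdivlMr//; nra.
Qed.

(** Here [|g| >= 1 - x], and [(x + y) * (1 - x) = y + x * (1 - x - y) >= y]. *)
Lemma normc_quotient_sub1 f g x y : x < 1 -> x + y <= 1 ->
  normc (g - 1) <= x -> normc (f - g) <= y -> normc (f / g - 1) <= x + y.
Proof.
move=> x1 xy hg hf; have x0 := le_trans (normc_ge0 _) hg.
have ng : 1 - x <= normc g.
  by have := ler_normcB g (g - 1); rewrite opprB addrC subrK normc1; lra.
have ng0 : 0 < normc g by lra.
have g0 : g != 0 by apply: contraTneq ng0 => ->; rewrite normc0 ltxx.
rewrite (_ : f / g - 1 = (f - g) / g); last by rewrite mulrBl divff.
rewrite normcM normcV ler_pdivrMr//.
have y0 := le_trans (normc_ge0 _) hf.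
by apply: le_trans hf _; nra.
Qed.

End Quotient.

(** * Coefficient bounds and the Rabotnov quotient *)

Lemma rabotnov_coef_le (R : realType) (alpha gamma : R) (beta : R[i]) n :
  1 <= gamma + alpha ->
  normc (rabotnov_coef alpha gamma beta n) <= (normc beta / (gamma + alpha)) ^+ n / n`!%:R.
Proof.
move=> s1.
rewrite /rabotnov_coef; move: (gamma + alpha) s1 => t t1.
have normcR x : 0 <= x -> normc x%:C = x :> R.
  by move=> x0; rewrite /= expr0n addr0 sqrtr_sqr ger0_norm.
have -> : normc (beta ^+ n * (Gamma t)%:C / (Gamma (t * n.+1%:R))%:C)
    = normc beta ^+ n * (Gamma t / Gamma (t * n.+1%:R)).
  by rewrite 2!normcM normcV normcX normcR ?normcR ?Gamma_ge0// mulrA.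
have b0 := normc_ge0 beta.
have t0 : 0 < t := lt_le_trans ltr01 t1.
have tn0 : 0 < t ^+ n * n`!%:R by rewrite mulr_gt0 ?exprn_gt0// ltr0n fact_gt0.
rewrite expr_div_n -mulrA -invfM ler_wpM2l ?exprn_ge0//.
(* Only [Gamma_ge0] is at hand; a zero denominator would make the quotient 0 by convention. *)
have [->|] := eqVneq (Gamma (t * n.+1%:R)) 0.
  by rewrite invr0 mulr0 invr_ge0 ltW.
rewrite neq_lt ltNge Gamma_ge0/= => G1.
by rewrite ler_pdivrMr// mulrC ler_pdivlMr// mulrA Gamma_mulS_ge.
Qed.

Lemma rabotnov_quotient_disc (R : realType) (alpha gamma : R) (beta : R[i]) m (z : R[i]) :
  1 <= gamma + alpha -> 3 * normc beta <= gamma + alpha -> normc z < 1 ->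
  let f : R[i] := derive1 (rabotnov alpha gamma beta) z in
  let g : R[i] := derive1 (rabotnov_psum alpha gamma beta m) z in
  f / g != 0 /\
  normc (f / g - 1) <= 2 * normc beta / (gamma + alpha - normc beta).
Proof.
move=> s1 sb z1 f g.
set s := gamma + alpha in s1 sb *; set b := normc beta in sb *.
have b0 : 0 <= b := normc_ge0 beta.
have z0 := normc_ge0 z.
pose r := b / s.
have r0 : 0 <= r by rewrite divr_ge0//; lra.
have r3 : 3 * r <= 1 by rewrite /r mulrA ler_pdivrMr; lra.
have r01 : 0 <= r < 1 by lra.
have hc n := rabotnov_coef_le beta n s1.
rewrite -/s -/b -/r in hc; set c := rabotnov_coef alpha gamma beta in hc.
have [D [[B hD] Df]] := derive1_series r01 hc z1.
pose d n := n.+1%:R * c n * z ^+ n.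
have Ef : f = 1 + D by exact: Df.
have Eg : g = 1 + \sum_(1 <= n < m.+1) d n by exact: (derive1_partial_sum r01 hc).
pose C := 2 * b / (s - b).
have CE : C = 2 / (1 - r) * r by rewrite /C /r; field; lra.
have C1 : C <= 1 by rewrite /C ler_pdivrMr; lra.
have C0 : 0 <= C by rewrite /C divr_ge0; lra.
have Cz : C * normc z < 1 by apply: le_lt_trans z1; rewrite ler_piMl.
(* One factor [|z|] is kept: it makes the final bound strictly less than 1 even when [C = 1]. *)
have d_le n : (0 < n)%N -> normc (d n) <= normc z * (2 * r ^+ n).
  case: n => // n _; rewrite mulrC.
  rewrite /d 2!normcM normc_nat normcX ler_pM ?mulr_ge0 ?normc_ge0 ?exprn_ge0//.
    by apply: (coef_mul_le r01 hc); exact: leqS_double_fact.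
  by rewrite exprS ler_piMr// exprn_ile1// ltW.
have sum_le N : \sum_(1 <= n < N) normc (d n) <= C * normc z.
  apply: (@le_trans _ _ (\sum_(1 <= n < N) normc z * (2 * r ^+ n))).
    by rewrite !big_nat; apply: ler_sum => n /andP[n0 _]; exact: d_le.
  rewrite -mulr_sumr mulrC ler_wpM2r// CE -{2}[r]expr1.
  exact: ler_sum_geometric (ler0n R 2) r01.
pose x := \sum_(1 <= n < m.+1) normc (d n).
have xC : x <= C * normc z := sum_le m.+1.
have hg : normc (g - 1) <= x.
  by rewrite Eg [1 + _]addrC addrK ler_normc_sum.
(* The terms beyond [m] get what the first [m] terms leave of the total budget [C * |z|]. *)
have hf : normc (f - g) <= C * normc z - x.
  apply: (ler_of_geometric_error r01 (B := B)).
  exists m.+1 => // N /= mN; rewrite Ef Eg.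
  have := sum_le N; rewrite (big_cat_nat (ltn0Sn m) mN)//= -/x => sN.
  have -> : 1 + D - (1 + \sum_(1 <= n < m.+1) d n) =
      \sum_(m.+1 <= n < N) d n + (D - \sum_(1 <= n < N) d n).
    by rewrite [\sum_(1 <= n < N) d n](big_cat_nat (ltn0Sn m) mN)//=; ring.
  apply: le_trans (ler_normcD _ _) _; apply: lerD; last exact: hD.
  apply: le_trans (ler_normc_sum _ _ _) _; lra.
have fg : normc (f / g - 1) <= C * normc z.
  by have := normc_quotient_sub1 _ _ hg hf; rewrite subrKC; apply; lra.
split; last by apply: le_trans fg _; rewrite ler_piMr// ltW.
(* A zero quotient would lie at distance 1 from 1, but [C * |z| < 1]. By the convention on division
   this also covers [g = 0]. *)
apply: contraTneq fg => ->.
by rewrite sub0r normcN normc1 -ltNge.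
Qed.

Theorem theorem1p5 (R : realType) (alpha gamma : R) (beta : R[i])
    (halpha : 0 <= alpha) (hgamma : 1 <= gamma)
    (hbeta : 3 * `|beta| <= (gamma + alpha)%:C)
    (m : nat) (z : R[i]) (hz : `|z| < 1) :
  ((gamma + alpha)%:C - 3 * `|beta|) / ((gamma + alpha)%:C - `|beta|)
    <= 'Re (derive1 (rabotnov alpha gamma beta) z
            / derive1 (rabotnov_psum alpha gamma beta m) z)
  /\
  ((gamma + alpha)%:C - `|beta|) / ((gamma + alpha)%:C + `|beta|)
    <= 'Re (derive1 (rabotnov_psum alpha gamma beta m) z
            / derive1 (rabotnov alpha gamma beta) z).
Proof.
have s1 : 1 <= gamma + alpha by lra.
have three : 3 = (3%:R)%:C :> R[i] by rewrite rmorph_nat.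
have sb : 3 * normc beta <= gamma + alpha.
  by rewrite -lecR rmorphM/= -three.
have z1 : normc z < 1 by rewrite -ltcR.
have b0 := normc_ge0 beta.
have [w0 w1] := rabotnov_quotient_disc m s1 sb z1.
(* This is the hypothesis [3 * |beta| <= gamma + alpha] rearranged. *)
have C1 : 2 * normc beta / (gamma + alpha - normc beta) <= 1.
  by rewrite ler_pdivrMr; lra.
have -> : ((gamma + alpha)%:C - 3 * `|beta|) / ((gamma + alpha)%:C - `|beta|)
    = ((gamma + alpha - 3 * normc beta) / (gamma + alpha - normc beta))%:C.
  by rewrite normr_normc three -rmorphM -!rmorphB fmorph_div.
have -> : ((gamma + alpha)%:C - `|beta|) / ((gamma + alpha)%:C + `|beta|)
    = ((gamma + alpha - normc beta) / (gamma + alpha + normc beta))%:C.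
  by rewrite normr_normc -rmorphB -rmorphD fmorph_div.
split; rewrite -[X in _ <= X]complexRe lecR.
  apply: le_trans (Re_disc_ge w1).
  (* With [s = gamma + alpha] and [b = |beta|], [1 - 2 * b / (s - b) = (s - 3 * b) / (s - b)]. *)
  by rewrite le_eqVlt; apply/orP; left; apply/eqP; field; lra.
rewrite -[X in complex.Re X]invf_div; apply: le_trans (Re_inv_disc_ge w0 C1 w1).
by rewrite le_eqVlt; apply/orP; left; apply/eqP; field; lra.
Qed.
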